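(* Let $(S,=,\#)$ be a set with apartness, $\varepsilon$ an equivalence on $S$ and $\kappa$ a co-equivalence on $S$. (i) $\kappa$ defines an apartness on the factor set $S/\varepsilon$ if and only if $\varepsilon\cap\kappa=\emptyset$. (ii) If $\varepsilon\cap\kappa=\emptyset$ and $S/\varepsilon$ is equipped with the apartness defined by $\kappa$, then the quotient map $\pi:S\to S/\varepsilon$, $\pi(x)=x\varepsilon$, is an se-surjection.
   Context: Constructive (Bishop-style) setting. A set with apartness $(S,=,\#)$: inhabited set with equality $=$ (an equivalence) and $\#$ with $\neg(x\#x)$, $x\#y\Rightarrow y\#x$, $x\#z\Rightarrow\forall y(x\#y\vee y\#z)$; an apartness is extensional w.r.t. the equality ($x\#y\wedge x=x'\wedge y=y'\Rightarrow x'\#y'$). A relation $\kappa$ on $S$ is a co-equivalence if it is symmetric, strongly irreflexive ($(x,y)\in\kappa\Rightarrow x\#y$) and co-transitive ($(x,y)\in\kappa\Rightarrow\forall z((x,z)\in\kappa\vee(z,y)\in\kappa)$). For an equivalence $\varepsilon$ on $S$, $S/\varepsilon$ is the set of classes $x\varepsilon$ with equality $x\varepsilon=y\varepsilon\iff(x,y)\in\varepsilon$. A relation $\alpha$ defines an apartness on $S/\varepsilon$ if the prescription $x\varepsilon\#y\varepsilon:\iff(x,y)\in\alpha$ gives an apartness on the set $(S/\varepsilon,=)$. An se-surjection is a surjective mapping $f$ with $f(x)\#f(y)\Rightarrow x\#y$. *)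

(* Defs.v *)
(* Constructive: no classical axiom is used. *)
From Stdlib Require Import Relations RelationClasses.

(* An inhabited Bishop set: equality is part of the structure. *)
Record bset := Bset {
  carrier :> Type;
  eqS : relation carrier;
  eqS_equiv : Equivalence eqS;
  bset_inhabited : inhabited carrier
}.
Arguments eqS {b} _ _.

Record is_apartness (S : bset) (ap : relation S) : Prop := IsApartness {
  ap_irrefl : forall x, ~ ap x x;
  ap_sym : forall x y, ap x y -> ap y x;
  ap_cotrans : forall x z, ap x z -> forall y, ap x y \/ ap y z;
  ap_ext : forall x y x' y', ap x y -> eqS x x' -> eqS y y' -> ap x' y'
}.

Record apset := Apset {
  base :> bset;
  apart : relation base;
  apartP : is_apartness base apart
}.
Arguments apart {a} _ _.

(* A relation on a Bishop set is a subset of S x S, hence extensional; for an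
   equivalence this amounts to containing the equality of S. *)
Record equivalence_on (S : bset) (eps : relation S) : Prop := EquivalenceOn {
  eqv_ext : forall x y x' y', eps x y -> eqS x x' -> eqS y y' -> eps x' y';
  eqv_equiv : Equivalence eps
}.

(* Extensionality of a co-equivalence follows from these three properties
   (see [coequivalence_ext]). *)
Record coequivalence_on (S : apset) (kappa : relation S) : Prop :=
  CoequivalenceOn {
  coeqv_sym : forall x y, kappa x y -> kappa y x;
  coeqv_strong_irrefl : forall x y, kappa x y -> apart x y;
  coeqv_cotrans : forall x y, kappa x y -> forall z, kappa x z \/ kappa z y
}.

Lemma coequivalence_ext (S : apset) (kappa : relation S) :
  coequivalence_on S kappa ->
  forall x y x' y', kappa x y -> eqS x x' -> eqS y y' -> kappa x' y'.
Proof.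
intros [ks ka kt].
assert (no : forall x x', eqS x x' -> ~ kappa x x').
{ intros x x' e k; apply (ap_irrefl _ _ (apartP S) x').
  apply (ap_ext _ _ (apartP S) x x' x' x'); [now apply ka | exact e |].
  apply (eqS_equiv S). }
intros x y x' y' k ex ey.
destruct (kt x y k x') as [h | h]; [now destruct (no _ _ ex h) |].
destruct (kt x' y h y') as [h' | h']; [exact h' |].
now destruct (no y y' ey); apply ks.
Qed.

Definition disjoint_rel {T : Type} (alpha beta : relation T) : Prop :=
  forall x y, ~ (alpha x y /\ beta x y).

(* The classes of [eps], as subsets of S. *)
Definition classes {S : bset} (eps : relation S) : Type :=
  { A : S -> Prop | exists x, forall y, A y <-> eps x y }.

Definition cls {S : bset} (eps : relation S) (x : S) : classes eps :=
  exist _ (fun y => eps x y)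
    (ex_intro _ x (fun y => conj (fun h => h) (fun h => h))).

(* Equality of classes is equality of subsets; [cls_eqP] shows that two classes
   are equal if and only if their representatives are related by [eps]. *)
Definition class_eq {S : bset} (eps : relation S) : relation (classes eps) :=
  fun A B => forall z, proj1_sig A z <-> proj1_sig B z.

Lemma class_eq_equiv (S : bset) (eps : relation S) : Equivalence (class_eq eps).
Proof. unfold class_eq; split; red; firstorder. Qed.

Lemma classes_inhabited (S : bset) (eps : relation S) : inhabited (classes eps).
Proof. destruct (bset_inhabited S) as [x]; exact (inhabits (cls eps x)). Qed.

Definition quot (S : bset) (eps : relation S) : bset :=
  Bset (classes eps) (class_eq eps) (class_eq_equiv S eps)
    (classes_inhabited S eps).

Definition quot_map {S : bset} (eps : relation S) : S -> quot S eps := cls eps.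

Lemma cls_eqP (S : bset) (eps : relation S) : equivalence_on S eps ->
  forall x y : S, @eqS (quot S eps) (quot_map eps x) (quot_map eps y) <-> eps x y.
Proof.
intros [_ [er es et]] x y; cbn; unfold class_eq; cbn; split.
- intros h; apply h, er.
- intros h z; split; intros k; [apply (et y x z); auto | now apply (et x y z)].
Qed.

(* R is the relation on S/eps prescribed by alpha. *)
Definition prescribed_by {S : bset} (eps alpha : relation S)
    (R : relation (quot S eps)) : Prop :=
  forall x y : S, R (quot_map eps x) (quot_map eps y) <-> alpha x y.

(* The prescription determines R up to logical equivalence as soon as R is
   extensional, so the existential quantifier only expresses that the
   prescription is consistent and yields an apartness. *)
Definition defines_apartness {S : bset} (eps alpha : relation S) : Prop :=
  exists R : relation (quot S eps),
    is_apartness (quot S eps) R /\ prescribed_by eps alpha R.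

Record se_surjection (S T : apset) (f : S -> T) : Prop := SeSurjection {
  map_ext : forall x y : S, eqS x y -> eqS (f x) (f y);
  map_surj : forall t : T, exists x : S, eqS (f x) t;
  map_se : forall x y : S, apart (f x) (f y) -> apart x y
}.

(* Main.v *)
(* If eps and kappa are disjoint then co-transitivity makes kappa invariant
   under eps: from kappa x y and eps x x', either kappa x x', which is excluded,
   or kappa x' y. So kappa descends to the classes, where its irreflexivity is
   again the disjointness. *)
Require Import Defs.
From Stdlib Require Import Relations RelationClasses.

Lemma coequivalence_compat (S : apset) (eps kappa : relation S) :
  coequivalence_on S kappa -> disjoint_rel eps kappa ->
  forall x y x' y', kappa x y -> eps x x' -> eps y y' -> kappa x' y'.
Proof.
intros [ks _ kt] dis x y x' y' k ex ey.
destruct (kt x y k x') as [h | h]; [now destruct (dis x x') |].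
destruct (kt x' y h y') as [h' | h']; [exact h' |].
destruct (dis y y'); split; [exact ey | now apply ks].
Qed.

(** Extensionality carries [eps x x] along the equality; this is what makes [quot_map] respect
    [eqS]. *)
Lemma equivalence_of_eqS (S : bset) (eps : relation S) :
  equivalence_on S eps -> forall x y, eqS x y -> eps x y.
Proof.
intros [ext [er _ _]] x y e.
apply (ext x x x y); [apply er | apply (eqS_equiv S) | exact e].
Qed.

(* Existential over members of the classes, since a representative cannot be
   chosen constructively. *)
Definition class_rel {S : bset} (eps kappa : relation S) :
    relation (quot S eps) :=
  fun A B => exists x y, proj1_sig A x /\ proj1_sig B y /\ kappa x y.

Lemma class_rel_prescribed (S : apset) (eps kappa : relation S) :
  equivalence_on S eps -> coequivalence_on S kappa -> disjoint_rel eps kappa ->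
  prescribed_by eps kappa (class_rel eps kappa).
Proof.
intros [_ [er es _]] co dis x y; split.
- intros (x' & y' & ex & ey & k); cbn in ex, ey.
  apply (coequivalence_compat S eps kappa co dis x' y'); auto.
- intros k; exists x, y; cbn; auto.
Qed.

Lemma class_rel_apartness (S : apset) (eps kappa : relation S) :
  equivalence_on S eps -> coequivalence_on S kappa -> disjoint_rel eps kappa ->
  is_apartness (quot S eps) (class_rel eps kappa).
Proof.
intros [_ [er es et]] [ks _ kt] dis; split.
- intros [A [a hA]] (x & y & ax & ay & k); cbn in ax, ay.
  (* Both [x] and [y] lie in the class of [a], hence [eps x y]. *)
  apply (dis x y); split; [| exact k].
  apply (et x a y); [apply es |]; now apply hA.
- intros A B (x & y & ax & bY & k); exists y, x; auto.
- intros A C (x & z & ax & cz & k) [B [b hB]].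
  (* Co-transitivity of [kappa] needs a point of the middle class; its representative [b] serves. *)
  assert (bb : B b) by (apply hB, er).
  destruct (kt x z k b) as [h | h]; [left; exists x, b | right; exists b, z]; auto.
- intros A B A' B' (x & y & ax & bY & k) eA eB; exists x, y.
  split; [now apply eA | split; [now apply eB | exact k]].
Qed.

(** A common pair would give classes that are both equal and apart, so by extensionality a class
    apart from itself. *)
Lemma defines_apartness_disjoint (S : bset) (eps kappa : relation S) :
  equivalence_on S eps -> defines_apartness eps kappa -> disjoint_rel eps kappa.
Proof.
intros Heps (R & HR & pR) x y [e k].
apply (ap_irrefl _ _ HR (quot_map eps y)).
apply (ap_ext _ _ HR (quot_map eps x) (quot_map eps y)).
- now apply pR.
- now apply cls_eqP.
- apply (eqS_equiv (quot S eps)).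
Qed.

(** Each class comes with the mere existence of a representative, which may be opened because the
    goal is a proposition. *)
Lemma quot_map_surj (S : bset) (eps : relation S) (A : quot S eps) :
  exists x, eqS (quot_map eps x) A.
Proof.
destruct A as [A [a hA]]; exists a; intros z; cbn; symmetry; apply hA.
Qed.

Theorem theorem15 (S : apset) (eps kappa : relation S)
    (Heps : equivalence_on S eps) (Hkappa : coequivalence_on S kappa) :
  (defines_apartness eps kappa <-> disjoint_rel eps kappa) /\
  (disjoint_rel eps kappa ->
   forall (R : relation (quot S eps)) (HR : is_apartness (quot S eps) R),
     prescribed_by eps kappa R ->
     se_surjection S (Apset (quot S eps) R HR) (quot_map eps)).
Proof.
split; [split |].
- now apply defines_apartness_disjoint.
- intros dis; exists (class_rel eps kappa); split.
  + now apply class_rel_apartness.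
  + now apply class_rel_prescribed.
- intros _ R HR pR; split.
  + intros x y e; apply (cls_eqP S eps Heps).
    now apply equivalence_of_eqS.
  + apply quot_map_surj.
  (* Apartness of the classes means [kappa x y], which lies inside the apartness of [S]. *)
  + intros x y r; apply (coeqv_strong_irrefl S kappa Hkappa).
    now apply pR.
Qed.
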